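(* Let $d\in\mathbb{N}$, $p\in\{0,\dots,d\}$, $\delta\ge0$, $m_0\in(0,1)$, and let $Z\sim\mathrm{split}_{m_0}\text{-}\chi^2_{p,d}(\delta)$. Then 1. $\mathbb{E}[Z]=p-d-d\,\frac{m_0}{1-m_0}+m_0\delta$; 2. $\mathrm{Var}[Z]=2(d-p)+4d\,\frac{m_0}{1-m_0}+2d\,\frac{m_0^2}{(1-m_0)^2}+4m_0\delta$.
   Context: The $d$-dimensional noncentral split chi-square distribution with $p$ degrees of freedom, noncentrality parameter $\delta\ge0$ and splitting ratio $m_0\in(0,1)$, denoted $\mathrm{split}_{m_0}\text{-}\chi^2_{p,d}(\delta)$, is the distribution of $$\Vert X_{[p]}+\sqrt{m_0}\,h\Vert^2-\Big\Vert X-\sqrt{\tfrac{m_0}{1-m_0}}\,Y\Big\Vert^2,$$ where $X,Y\sim\mathcal N_d(0,\mathrm{Id})$ are independent standard normal vectors in $\mathbb{R}^d$, $X_{[p]}$ is the vector of the first $p$ components of $X$, and $h\in\mathbb{R}^p$ is such that $h^Th=\delta$ (the distribution depends on $h$ only through $h^Th$). $\Vert\cdot\Vert$ is the Euclidean norm. *)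

(* Defs.v *)
From HB Require Import structures.
From mathcomp Require Import all_boot all_order all_algebra.
From mathcomp Require Import all_classical all_reals all_analysis.

Set Implicit Arguments.
Unset Strict Implicit.
Unset Printing Implicit Defensive.

Import Order.TTheory GRing.Theory Num.Theory.
Import numFieldNormedType.Exports.

Local Open Scope classical_set_scope.
Local Open Scope ring_scope.

(* The library's norm `|x| on matrices is the sup norm. *)
Definition enorm (R : realType) (n : nat) (x : 'cV[R]_n) : R :=
  Num.sqrt (\sum_(i < n) x i ord0 ^+ 2).

(* Random vectors take values in n.-tuple R, which carries the product
   sigma-algebra; column vectors do not have a measurable structure. *)
Definition tcol (R : realType) (n : nat) (x : n.-tuple R) : 'cV[R]_n :=
  \col_(i < n) tnth x i.

Definition independent_pair (R : realType) (d d1 d2 : measure_display)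
    (T : measurableType d) (T1 : measurableType d1) (T2 : measurableType d2)
    (P : probability T R) (X : {RV P >-> T1}) (Y : {RV P >-> T2}) : Prop :=
  forall (A : set T1) (B : set T2), measurable A -> measurable B ->
    P (X @^-1` A `&` Y @^-1` B) = (P (X @^-1` A) * P (Y @^-1` B))%E.

Definition independent_components (R : realType) (d : measure_display)
    (T : measurableType d) (P : probability T R) (n : nat)
    (X : {RV P >-> n.-tuple R}) : Prop :=
  forall (J : {set 'I_n}) (A : 'I_n -> set R), (forall i, measurable (A i)) ->
    P [set w | forall i, i \in J -> A i (tnth (X w) i)] =
    (\prod_(i in J) P [set w | A i (tnth (X w) i)])%E.

(* X ~ N_n(0, Id).  The second parameter of normal_prob is the standard
   deviation. *)
Definition standard_normal (R : realType) (d : measure_display)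
    (T : measurableType d) (P : probability T R) (n : nat)
    (X : {RV P >-> n.-tuple R}) : Prop :=
  independent_components X /\
  forall (i : 'I_n) (A : set R), measurable A ->
    P [set w | A (tnth (X w) i)] = normal_prob 0 1 A.

Definition split_chi2_expr (R : realType) (d p : nat) (hp : (p <= d)%N)
    (m0 : R) (h : 'cV[R]_p) (x y : 'cV[R]_d) : R :=
  enorm (rowsub (widen_ord hp) x + Num.sqrt m0 *: h) ^+ 2
  - enorm (x - Num.sqrt (m0 / (1 - m0)) *: y) ^+ 2.

(* mu is the split_{m0}-chi^2_{p,d}(delta) distribution.  Laws are compared on
   measurable sets only, since set functions such as distribution P Z are total
   in the library. *)
Definition split_chi2 (R : realType) (d p : nat) (hp : (p <= d)%N)
    (m0 delta : R) (mu : set R -> \bar R) : Prop :=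
  exists (dT : measure_display) (T : measurableType dT) (P : probability T R)
         (X Y : {RV P >-> d.-tuple R}) (h : 'cV[R]_p),
    [/\ standard_normal X, standard_normal Y, independent_pair X Y,
        (h^T *m h) ord0 ord0 = delta &
        forall A : set R, measurable A ->
          mu A =
          P [set w | A (split_chi2_expr hp m0 h (tcol (X w)) (tcol (Y w)))]].

(* Main.v *)
(** Write [c] for [sqrt (m0 / (1 - m0))], [a] for [sqrt m0], and [b_i] for the
    indicator of [i < p].  Coordinate by coordinate,
      [Z = E Z + \sum_i ((b_i - 1) (X_i^2 - 1) + 2 a h_i X_i + 2 c X_i Y_i
                         - c^2 (Y_i^2 - 1))],
    where every summand is a product of Hermite polynomials of degree at most 2
    in independent standard normal variables.  Distinct products are orthogonal
    and centred, so the mean is the constant term and the variance is the sum of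
    the squared coefficients weighted by the squared norms 2, 1, 1, 2. *)
Require Import Defs.
From HB Require Import structures.
From mathcomp Require Import all_boot all_order all_algebra.
From mathcomp Require Import all_classical all_reals all_analysis.
From mathcomp Require Import measurable_realfun ring lra zify.

Import Order.TTheory GRing.Theory Num.Theory.
Import numFieldNormedType.Exports.

Local Open Scope classical_set_scope.
Local Open Scope ring_scope.

Set Implicit Arguments.
Unset Strict Implicit.
Unset Printing Implicit Defensive.

(** * The standard normal density: change of variables, decay, integration by parts *)

Lemma ge0_integral_normal_prob (R : realType) (m s : R) (f : R -> R) :
  measurable_fun [set: R] f -> (forall x, 0 <= f x) ->
  (\int[normal_prob m s]_x (f x)%:E =
   \int[lebesgue_measure]_x (f x * normal_pdf m s x)%:E)%E.
Proof.
move=> mf f0.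
have dom := normal_prob_dominates m s.
have mfE : measurable_fun [set: R] (EFin \o f) by exact/measurable_EFinP.
have f0E x : (0 <= (EFin \o f) x)%E by rewrite lee_fin.
have mpdf : measurable_fun [set: R] (EFin \o normal_pdf m s).
  by apply/measurable_EFinP; exact: measurable_normal_pdf.
have iRN := Radon_Nikodym_SigmaFinite.f_integrable dom.
rewrite
  -(Radon_Nikodym_SigmaFinite.change_of_variables dom f0E measurableT mfE).
apply: ae_eq_integral => //.
- by apply: emeasurable_funM => //; exact: measurable_int iRN.
- by apply/measurable_EFinP/measurable_funM => //; exact: measurable_normal_pdf.
(* The Radon-Nikodym derivative and [normal_pdf] have the same integral over every measurable set,
   hence agree almost everywhere. *)
- have RN_pdf : ae_eq lebesgue_measure setT
      (Radon_Nikodym_SigmaFinite.f (normal_prob m s) lebesgue_measure)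
      (EFin \o normal_pdf m s).
    apply: integral_ae_eq => //.
    by move=> A _ mA; rewrite -Radon_Nikodym_SigmaFinite.f_integral.
  exact: ae_eqe_mul2l RN_pdf.
Qed.

Lemma normal_pdf01E (R : realType) :
  normal_pdf 0 1 = (fun x : R => normal_peak 1 * expR (- (x ^+ 2 / 2))).
Proof.
rewrite normal_pdfE ?oner_eq0//; apply/funext => x /=.
rewrite -[LHS]/(normal_peak 1 * normal_fun 0 1 x).
by rewrite /normal_fun subr0 expr1n mulNr.
Qed.

Lemma is_derive_normal_pdf01 (R : realType) (x : R) :
  is_derive x 1 (normal_pdf 0 1) (- x * normal_pdf 0 1 x).
Proof.
rewrite normal_pdf01E; pose g (y : R) := - (y ^+ 2 / 2).
have dg : is_derive x 1 g (- x).
  by rewrite /g; apply: is_derive_eq; rewrite /GRing.scale/=; field.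
have dexp := is_derive1_comp (is_derive_expR (g x)) dg.
have dz := is_deriveZ (normal_peak 1) dexp.
by apply: (is_derive_eq dz); rewrite /GRing.scale/= -/(g x); ring.
Qed.

(** The exponential series gives [expR t] at least $t^{k+1}/(k+1)!$ at $t = y^2/2$, which bounds the
    product by $C/y^{k+2}$, hence by $C/y$ for $y \ge 1$. The sequence is shifted by one so that $y
    = n+1$ is positive and $1/y$ is [harmonic n]. *)
Lemma normal_pdf_pow_cvg0 (R : realType) (k : nat) :
  (n%:R ^+ k * normal_pdf 0 1 n%:R : R) @[n --> \oo] --> (0 : R).
Proof.
rewrite -cvg_shiftS/=.
pose C : R := normal_peak 1 * k.+1`!%:R * 2 ^+ k.+1.
apply: (@squeeze_cvgr _ _ _ _ (cst 0) (fun n => C * harmonic n)).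
- near=> n; set y : R := n.+1%:R.
  have y0 : 0 < y by rewrite ltr0n.
  apply/andP; split.
    by rewrite mulr_ge0 ?exprn_ge0 ?normal_pdf_ge0 ?ltW.
  rewrite normal_pdf01E expRN; set t := y ^+ 2 / 2.
  have t0 : 0 < t by rewrite divr_gt0 ?exprn_gt0.
  have e : (expR t)^-1 <= k.+1`!%:R / t ^+ k.+1.
    rewrite -[leRHS]invf_div lef_pV2 ?posrE ?expR_gt0//; last first.
      by rewrite divr_gt0 ?exprn_gt0 ?ltr0n ?fact_gt0.
    by rewrite (le_trans _ (expR_ge1Dxn k (ltW t0)))// lerDr.
  have p0 : 0 <= y ^+ k * normal_peak 1.
    by rewrite mulr_ge0 ?exprn_ge0 ?normal_peak_ge0 ?ltW.
  rewrite mulrA (le_trans (ler_wpM2l p0 e))//.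
  have tE : t ^+ k.+1 = y ^+ k * y ^+ k.+2 / 2 ^+ k.+1.
    by rewrite /t expr_div_n -exprM -exprD; congr (y ^+ _ / _); lia.
  have yn m : y ^+ m != 0 by rewrite expf_neq0 ?gt_eqF.
  have -> : y ^+ k * normal_peak 1 * (k.+1`!%:R / t ^+ k.+1) = C / y ^+ k.+2.
    by rewrite tE /C; field; rewrite !yn expf_neq0.
  rewrite ler_wpM2l//.
    by rewrite !mulr_ge0 ?normal_peak_ge0 ?exprn_ge0 ?ler0n.
  rewrite lef_pV2 ?posrE ?exprn_gt0//.
  by rewrite exprS ler_peMr ?(ltW y0)// exprn_ege1// ler1n.
- exact: cvg_cst.
- rewrite -[X in _ --> X](mulr0 C); apply: cvgMl_tmp; exact: cvg_harmonic.
Unshelve. all: by end_near.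
Qed.

Lemma continuous_pow_normal_pdf (R : realType) (k : nat) :
  continuous (fun x : R => x ^+ k * normal_pdf 0 1 x).
Proof.
move=> x; apply: cvgM; first exact: exprn_continuous.
by apply: continuous_normal_pdf; rewrite oner_eq0.
Qed.

Lemma measurable_pow_normal_pdf (R : realType) (k : nat) (D : set R) :
  measurable_fun D (fun x : R => (x ^+ k * normal_pdf 0 1 x)%:E).
Proof.
apply/measurable_EFinP/measurable_funTS.
by apply: continuous_measurable_fun; exact: continuous_pow_normal_pdf.
Qed.

(** Integration by parts: as the density $\varphi$ satisfies $\varphi' = -x\varphi$, the derivative
    of $x^{k+1}\varphi$ is $(k+1)x^k\varphi - x^{k+2}\varphi$. The boundary term at 0 vanishes
    because the exponent is positive. *)
Lemma integral_pow_normal_pdf_rec (R : realType) (k n : nat) :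
  (\int[@lebesgue_measure R]_(x in `[0%R, n%:R])
     (x ^+ k.+2 * normal_pdf 0 1 x)%:E =
   k.+1%:R%:E * \int[@lebesgue_measure R]_(x in `[0%R, n%:R])
     (x ^+ k * normal_pdf 0 1 x)%:E -
   (n%:R ^+ k.+1 * normal_pdf 0 1 n%:R)%:E)%E.
Proof.
pose a j (x : R) := x ^+ j * normal_pdf 0 1 x.
have ca j (D : set R) : {within D, continuous (a j)}.
  exact/continuous_subspaceT/continuous_pow_normal_pdf.
have ia j : lebesgue_measure.-integrable `[0%R, n%:R] (EFin \o a j).
  by apply: continuous_compact_integrable; [exact: segment_compact|exact: ca].
pose f x := k.+1%:R * a k x - a k.+2 x.
have da (x : R) : is_derive x 1 (a k.+1) (f x).
  have dphi := is_derive_normal_pdf01 x.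
  have dx : is_derive x 1 (fun y : R => y ^+ k.+1) (k.+1%:R * x ^+ k).
    apply: DeriveDef; first exact: exprn_derivable.
    by rewrite exp_derive /GRing.scale/= mulr1.
  apply: (is_derive_eq (is_deriveM dx dphi)).
  rewrite /f /a /GRing.scale/= !exprS; ring.
(* The fundamental theorem of calculus requires a nondegenerate interval, so [n = 0] is settled
   separately. *)
case: n => [|n] in ia *.
  rewrite set_itv1 !integral_set1 mule0 expr0n mul0r.
  by rewrite sube0.
have n0 : 0 < n.+1%:R :> R by rewrite ltr0n.
have dca : derivable_oo_LRcontinuous (a k.+1) 0 n.+1%:R.
  by split => [x _| |]; [have [] := da x|
    apply: cvg_at_right_filter; exact: continuous_pow_normal_pdf|
    apply: cvg_at_left_filter; exact: continuous_pow_normal_pdf].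
have cf : {within `[0, n.+1%:R], continuous f}.
  apply: continuous_subspaceT => x.
  by apply: cvgB; [apply: cvgMl_tmp|]; exact: continuous_pow_normal_pdf.
have dE : {in `]0, n.+1%:R[, (a k.+1)^`()%classic =1 f}.
  by move=> x _; rewrite derive1E; have [_] := da x.
have := continuous_FTC2 n0 cf dca dE.
have iZ : lebesgue_measure.-integrable `[0%R, n.+1%:R]
    (EFin \o (fun x => k.+1%:R * a k x)).
  exact: (@integrableZl _ _ R lebesgue_measure _ _ k.+1%:R (EFin \o a k)).
rewrite /f; under eq_integral do rewrite EFinB.
rewrite integralB_EFin//; under eq_integral do rewrite EFinM.
have a0 : a k.+1 0 = 0 by rewrite /a expr0n mul0r.
rewrite integralZl ?ia// a0 sube0 -/(a _ _).
rewrite -[in RHS]/(a k.+1 _) -[in RHS]/(a k) -/(a k.+2).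
have finI j : (\int[@lebesgue_measure R]_(x in `[0%R, n.+1%:R]) (a j x)%:E
    \is a fin_num)%E.
  by apply: integrable_fin_num => //; exact: ia.


rewrite -(fineK (finI k)) -(fineK (finI k.+2)) -EFinM -!EFinB => -[e].
by congr EFin; rewrite -e; ring.
Qed.

(** The limit of the recurrence on [[0, n]], whose boundary term tends to 0. Even exponents keep the
    integrand nonnegative, so the truncated integrals converge without a prior proof that the limits
    are finite. *)
Lemma integral0y_pow_normal_pdf (R : realType) (k : nat) :
  (\int[@lebesgue_measure R]_(x in `[0%R, +oo[)
     (x ^+ k.+1.*2 * normal_pdf 0 1 x)%:E =
   k.*2.+1%:R%:E * \int[@lebesgue_measure R]_(x in `[0%R, +oo[)
     (x ^+ k.*2 * normal_pdf 0 1 x)%:E)%E.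
Proof.
have cvgk j : (\int[@lebesgue_measure R]_(x in `[0%R, n%:R])
     (x ^+ j.*2 * normal_pdf 0 1 x)%:E @[n --> \oo] -->
   \int[@lebesgue_measure R]_(x in `[0%R, +oo[)
     (x ^+ j.*2 * normal_pdf 0 1 x)%:E)%E.
  apply: ge0_cvgn_integral.
    by move=> x; rewrite mulr_ge0 ?normal_pdf_ge0// exprn_even_ge0// odd_double.
  by apply/measurable_EFinP; exact: measurable_pow_normal_pdf.
rewrite -(cvg_lim _ (cvgk k.+1))// -[RHS]sube0; apply/cvg_lim => //.
under eq_fun do rewrite doubleS integral_pow_normal_pdf_rec.
apply: cvgeB.
- by rewrite fin_num_adde_defl.
- by apply: cvgeZl => //; exact: cvgk.
- by apply: cvg_EFin; [exact: nearW|exact: normal_pdf_pow_cvg0].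
Qed.

(** * Calculus of finite means *)

(** Integrability travels with the value, so that linearity applies without side conditions and
    values stay in [R]. *)
Definition has_mean (R : realType) (dT : measure_display)
    (T : measurableType dT) (mu : set T -> \bar R) (f : T -> R) (m : R) : Prop :=
  mu.-integrable [set: T] (EFin \o f) /\ (\int[mu]_x (f x)%:E = m%:E)%E.

Section has_mean.
Context (R : realType) (dT : measure_display) (T : measurableType dT).
Context (mu : {measure set T -> \bar R}).

Lemma integrable_has_mean (f : T -> R) :
  mu.-integrable [set: T] (EFin \o f) ->
  has_mean mu f (fine (\int[mu]_x (f x)%:E)%E).
Proof. by move=> fi; split => //; rewrite fineK// integrable_fin_num. Qed.

Lemma ge0_has_mean (f : T -> R) (m : R) : measurable_fun [set: T] f ->
  (forall x, 0 <= f x) -> (\int[mu]_x (f x)%:E = m%:E)%E -> has_mean mu f m.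
Proof.
move=> mf f0 fm; split => //; apply/integrableP; split.
  exact/measurable_EFinP.
under eq_integral do rewrite /= ger0_norm//.
by rewrite fm ltry.
Qed.

Lemma has_meanD (f g : T -> R) (a b : R) :
  has_mean mu f a -> has_mean mu g b ->
  has_mean mu (fun x => f x + g x) (a + b).
Proof.
move=> [fi fa] [gi gb]; split.
  exact: (@integrableD _ _ _ mu _ _ (EFin \o f) (EFin \o g)).
under eq_integral do rewrite EFinD.
by rewrite integralD_EFin// fa gb.
Qed.

Lemma has_meanZ (k : R) (f : T -> R) (a : R) :
  has_mean mu f a -> has_mean mu (fun x => k * f x) (k * a).
Proof.
move=> [fi fa]; split.
  exact: (@integrableZl _ _ _ mu _ _ k (EFin \o f)).
under eq_integral do rewrite EFinM.
by rewrite integralZl// fa.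
Qed.

Lemma has_mean0 : has_mean mu (fun=> 0) 0.
Proof. by split; [exact: integrable0|rewrite integral0]. Qed.

Lemma has_mean_sum (I : finType) (f : I -> T -> R) (a : I -> R) :
  (forall i, has_mean mu (f i) (a i)) ->
  has_mean mu (fun x => \sum_i f i x) (\sum_i a i).
Proof.
move=> fa.
suff H (s : seq I) :
  has_mean mu (fun x => \sum_(i <- s) f i x) (\sum_(i <- s) a i).
  exact: H.
elim: s => [|i s IHs].
  rewrite big_nil; under eq_fun do rewrite big_nil.
  exact: has_mean0.
rewrite big_cons; under eq_fun do rewrite big_cons.
exact: has_meanD.
Qed.
End has_mean.

Lemma has_mean_cst (R : realType) (dT : measure_display) (T : measurableType dT)
  (P : probability T R) (k : R) : has_mean P (fun=> k) k.
Proof.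
split; last by rewrite integral_cst//= probability_setT mule1.
by apply/finite_measure_integrable_cst.
Qed.

(** * Moments of the standard normal law *)

(** Folding the line at 0 turns both sides into the same two integrals over the half-line, in
    opposite order. *)
Lemma ge0_integral_oppr (R : realType) (g : R -> R) :
  continuous g -> (forall x, 0 <= g x) ->
  (\int[lebesgue_measure]_x (g x)%:E = \int[lebesgue_measure]_x (g (- x))%:E)%E.
Proof.
have half (h : R -> R) : continuous h -> (forall x, 0 <= h x) ->
    (\int[lebesgue_measure]_x (h x)%:E =
     \int[lebesgue_measure]_(x in `[0%R, +oo[) (h x)%:E +
     \int[lebesgue_measure]_(x in `[0%R, +oo[) (h (- x))%:E)%E.
  move=> ch h0.
  have mh : measurable_fun [set: R] h by exact: continuous_measurable_fun.
  rewrite -(setUv `[0%R, +oo[%classic) ge0_integral_setU//=.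
  - rewrite setCitvr integral_itv_bndo_bndc; last first.
      exact/measurable_EFinP/measurable_funTS.
    rewrite -{2}oppr0 ge0_integration_by_substitutionNy//.
    exact: continuous_subspaceT.
  - exact: measurableC.
  - by apply/measurable_EFinP; rewrite setUv.
  - by move=> x _; rewrite lee_fin.
  - exact/disj_setPCl.
move=> cg g0; rewrite half// [RHS]half//.
  by rewrite addeC; congr +%E; apply: eq_integral => x _; rewrite /= opprK.
move=> x; apply: continuous_comp; [exact: opp_continuous|exact: cg].
Qed.

(** The product is the double factorial $(2k-1)!!$. By symmetry each integral is twice its half-line
    part, where passing from exponent $2k$ to $2k+2$ multiplies by $2k+1$. *)
Lemma normal_even_moment (R : realType) (k : nat) :
  has_mean (@normal_prob R 0 1) (fun x => x ^+ k.*2)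
    (\prod_(i < k) i.*2.+1%:R).
Proof.
have p0 j (x : R) : 0 <= x ^+ j.*2 by rewrite exprn_even_ge0// odd_double.
have half j : (\int[@lebesgue_measure R]_x (x ^+ j.*2 * normal_pdf 0 1 x)%:E =
    2%:E * \int[@lebesgue_measure R]_(x in `[0%R, +oo[)
      (x ^+ j.*2 * normal_pdf 0 1 x)%:E)%E.
  rewrite ge0_symfun_integralT ?set_itvcy//.
  - by move=> x; rewrite mulr_ge0 ?normal_pdf_ge0.
  - exact: continuous_pow_normal_pdf.
  - move=> x /=; rewrite normal_pdf01E !sqrrN exprNn.
    by rewrite -signr_odd odd_double mul1r.
have mX j : measurable_fun [set: R] (fun x => x ^+ j.*2).
  exact: exprn_measurable.
apply: ge0_has_mean => //; rewrite ge0_integral_normal_prob//.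
elim: k => [|k IHk].
  rewrite big_ord0; under eq_integral do rewrite mul1r.
  exact: integral_normal_pdf.
rewrite half integral0y_pow_normal_pdf muleCA -half IHk -EFinM big_ord_recr/=.
by rewrite mulrC.
Qed.

(** Reflection preserves the law and negates $x^k$, so the moment [e] satisfies $e = -e$. Adding $1
    + x^{2k}$ first makes the integrand nonnegative. *)
Lemma normal_odd_moment (R : realType) (k : nat) : odd k ->
  has_mean (@normal_prob R 0 1) (fun x => x ^+ k) 0.
Proof.
move=> ok.
(* Follows from $(|x^k| - 1)^2 \ge 0$; it yields both the integrability of $x^k$ and the
   nonnegativity of [g]. *)
have bnd (x : R) : `|x ^+ k| <= 1 + x ^+ k.*2.
  rewrite -muln2 exprM.
  have : 0 <= (`|x ^+ k| - 1) ^+ 2 by rewrite sqr_ge0.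
  rewrite -(real_normK (num_real (x ^+ k))); have := normr_ge0 (x ^+ k).
  nra.
have c := has_meanD (has_mean_cst (normal_prob 0 1) 1) (normal_even_moment R k).
have [e ek] : exists e, has_mean (@normal_prob R 0 1) (fun x => x ^+ k) e.
  eexists; apply: integrable_has_mean; have [i2 _] := c.
  apply: le_integrable i2 => //.
    apply/measurable_EFinP; exact: exprn_measurable.
  by move=> x _; rewrite lee_fin [leRHS]ger0_norm ?bnd// (le_trans _ (bnd x)).
have [_ c1] := has_meanD c ek.
have [_ c2] := has_meanD c (has_meanZ (-1) ek).
(* Nonnegative functions can be reflected without an integrability argument. *)
pose g (x : R) := 1 + x ^+ k.*2 + x ^+ k.
have g0 x : 0 <= g x by have := bnd x; rewrite ler_norml /g => /andP[]; lra.
have cg : continuous g.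
  move=> x; apply: cvgD; last exact: exprn_continuous.
  by apply: cvgD; [exact: cvg_cst|exact: exprn_continuous].
have mg : measurable_fun [set: R] g by exact: continuous_measurable_fun.
have mgN : measurable_fun [set: R] (fun x => g (- x)).
  exact: (measurableT_comp mg).
have pdfN (x : R) : normal_pdf 0 1 (- x) = normal_pdf 0 1 x.
  by rewrite normal_pdf01E sqrrN.
have gN : (\int[@normal_prob R 0 1]_x (g x)%:E =
    \int[@normal_prob R 0 1]_x (g (- x))%:E)%E.
  rewrite !ge0_integral_normal_prob// ge0_integral_oppr.
  - by apply: eq_integral => x _; rewrite pdfN.
  - move=> x; apply: cvgM; first exact: cg.
    by apply: continuous_normal_pdf; rewrite oner_eq0.
  - by move=> x; rewrite mulr_ge0 ?normal_pdf_ge0.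
have c2' : (\int[@normal_prob R 0 1]_x (g (- x))%:E =
    (1 + \prod_(i < k) i.*2.+1%:R + -1 * e)%:E)%E.
  rewrite -c2; apply: eq_integral => x _; rewrite /g !(exprNn x).
  rewrite -(signr_odd _ k) ok -(signr_odd _ k.*2) odd_double.
  by rewrite expr0 expr1 mul1r.
move: gN; rewrite c2' [LHS]c1 => -[e0].
have ee : e = 0 by lra.
by rewrite ee in ek.
Qed.

(** * Means under equal laws and of independent products *)

Lemma eq_measure_has_mean (R : realType) (dT : measure_display)
    (T : measurableType dT) (mu nu : {measure set T -> \bar R})
    (f : T -> R) (m : R) :
  (forall A, measurable A -> mu A = nu A) -> has_mean mu f m -> has_mean nu f m.
Proof.
move=> munu [/integrableP[mf fi] fm].
split; last by rewrite (eq_measure_integral mu)// => A mA _; rewrite munu.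
apply/integrableP; split => //.
by rewrite (eq_measure_integral mu)// => A mA _; rewrite munu.
Qed.

Section laws.
Context (R : realType) (d d1 : measure_display).
Context (T : measurableType d) (T1 : measurableType d1).
Context (P : probability T R) (X : {RV P >-> T1}).

Lemma has_mean_distribution (f : T1 -> R) (m : R) :
  measurable_fun [set: T1] f ->
  has_mean (distribution P X) f m <-> has_mean P (f \o X) m.
Proof.
move=> mf; have mEf : measurable_fun [set: T1] (EFin \o f).
  exact/measurable_EFinP.
have iE : (distribution P X).-integrable setT (EFin \o f) <->
    P.-integrable setT (EFin \o (f \o X)).
  have absE : (\int[distribution P X]_y `|(f y)%:E| =
      \int[P]_x `|(f (X x))%:E|)%E.
    rewrite (ge0_integral_distribution X (f := abse \o (EFin \o f)))//.
      exact: measurableT_comp.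
    by move=> y; exact: abse_ge0.
  split => /integrableP[_ fi]; apply/integrableP; split => //.
  - by apply/measurable_EFinP; exact: measurableT_comp.
  - by rewrite -absE.
  - by rewrite absE.
have intE : P.-integrable setT (EFin \o (f \o X)) ->
    (\int[distribution P X]_y (f y)%:E = \int[P]_x (f (X x))%:E)%E.
  by move=> fi; rewrite (integral_distribution (f := EFin \o f)).
split => -[fi fm].
- by have fi' := iE.1 fi; split => //; rewrite -intE.
- by split; [exact/iE|rewrite intE].
Qed.

Lemma has_mean_law (mu : {measure set T1 -> \bar R}) (f : T1 -> R) (m : R) :
  (forall A, measurable A -> P (X @^-1` A) = mu A) ->
  has_mean mu f m -> has_mean P (f \o X) m.
Proof.
move=> Xmu fm; apply/has_mean_distribution.
  by have [/integrableP[/measurable_EFinP]] := fm.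
by apply: eq_measure_has_mean fm => A mA; rewrite -Xmu.
Qed.

End laws.

(** Independence makes the joint law agree with the product law on rectangles, hence everywhere by
    uniqueness of the product measure; Fubini then factors the integral. *)
Lemma has_mean_independent (R : realType) (d d1 d2 : measure_display)
    (T : measurableType d) (T1 : measurableType d1) (T2 : measurableType d2)
    (P : probability T R) (X : {RV P >-> T1}) (Y : {RV P >-> T2})
    (f : T1 -> R) (g : T2 -> R) (a b : R) :
  independent_pair X Y ->
  measurable_fun [set: T1] f -> measurable_fun [set: T2] g ->
  has_mean P (f \o X) a -> has_mean P (g \o Y) b ->
  has_mean P (fun w => f (X w) * g (Y w)) (a * b).
Proof.
move=> indXY mf mg /(has_mean_distribution X _ mf)[fi fa].
move=> /(has_mean_distribution Y _ mg)[gi gb].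
have mXY : measurable_fun [set: T] (fun w => (X w, Y w)).
  exact: measurable_fun_pair.
pose XY : {RV P >-> (T1 * T2)%type} := mfun_Sub (mem_set mXY).
pose h (z : T1 * T2) := f z.1 * g z.2.
have mh : measurable_fun [set: T1 * T2] h.
  by apply: measurable_funM; apply: measurableT_comp.
apply: (has_mean_distribution XY _ mh).1.
set muX := distribution P X; set muY := distribution P Y.
suff hp : has_mean (muX \x muY)%E h (a * b).
  apply: eq_measure_has_mean hp => A mA.
  apply: product_measure_unique => // B C mB mC.
have mEh : measurable_fun [set: T1 * T2] (EFin \o h) by exact/measurable_EFinP.
(* Tonelli: the iterated integral of [|h|] is a product of two finite integrals, so [h] is
   integrable and Fubini applies. *)
have inner x : (\int[muY]_y `|(EFin \o h) (x, y)| =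
    `|f x|%:E * \int[muY]_y `|(g y)%:E|)%E.
  rewrite -integralZl//; last exact: (integrable_abse gi).
  by apply: eq_integral => y _; rewrite /h/= normrM EFinM.
have hi : (muX \x muY)%E.-integrable setT (EFin \o h).
  apply/integrable12ltyP => //.
  under eq_integral do rewrite inner.
  have [[_ fl] [_ gl]] := (integrableP _ _ _ fi, integrableP _ _ _ gi).
  have gG : (\int[muY]_y `|(g y)%:E| \is a fin_num)%E.
    by rewrite ge0_fin_numE//; exact: integral_ge0.
  rewrite -(fineK gG) integralZr//; last exact: (integrable_abse fi).
  rewrite fineK// lte_mul_pinfty//; first exact: integral_ge0.
  by rewrite ge0_fin_numE//; exact: integral_ge0.
split => //; rewrite -integral12_prod_meas1//.
have Fh x : fubini_F muY (EFin \o h) x = ((f x)%:E * b%:E)%E.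
  by rewrite /fubini_F -gb -integralZl.
under eq_integral do rewrite Fh.
by rewrite integralZr// fa EFinM.
Qed.

(** * Orthogonal sums and Hermite polynomials *)

Lemma eq_has_mean (R : realType) (dT : measure_display) (T : measurableType dT)
    (mu : {measure set T -> \bar R}) (f g : T -> R) (a b : R) :
  f =1 g -> a = b -> has_mean mu f a -> has_mean mu g b.
Proof. by move=> /funext -> ->. Qed.

(** Pythagoras: in the double sum that expands the square, only the diagonal survives. *)
Lemma has_mean_orthogonal_sum (R : realType) (dT : measure_display)
    (T : measurableType dT) (mu : {measure set T -> \bar R}) (J : finType)
    (U : J -> T -> R) (s c : J -> R) :
  (forall i j,
    has_mean mu (fun w => U i w * U j w) (if i == j then s i else 0)) ->
  has_mean mu (fun w => (\sum_j c j * U j w) ^+ 2) (\sum_j c j ^+ 2 * s j).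
Proof.
move=> UU; have H := has_mean_sum (fun i => has_mean_sum (fun j =>
  has_meanZ (c i * c j) (UU i j))).
apply: eq_has_mean H.
  move=> w; rewrite expr2 big_distrlr/=.
  by apply: eq_bigr => i _; apply: eq_bigr => j _; ring.
apply: eq_bigr => i _; rewrite (bigD1 i)//= eqxx big1 ?addr0 ?expr2// => j ij.
by rewrite eq_sym (negbTE ij) mulr0.
Qed.

(* Only degrees [n <= 2] are meant; larger [n] repeat degree 2. *)
Definition hermite (R : realType) (n : nat) (x : R) : R :=
  match n with 0 => 1 | 1 => x | _ => x ^+ 2 - 1 end.

Lemma measurable_hermite (R : realType) (n : nat) :
  measurable_fun [set: R] (@hermite R n).
Proof.
case: n => [|[|n]]; [exact: measurable_cst|exact: (@measurable_id _ R)|].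
by apply: measurable_funB; [exact: exprn_measurable|exact: measurable_cst].
Qed.

(** Degree 4 covers every product of two Hermite polynomials of degree at most 2. Odd powers drop
    out, and 3 is the fourth moment. *)
Lemma normal_poly4 (R : realType) (c0 c1 c2 c3 c4 : R) :
  has_mean (@normal_prob R 0 1)
    (fun x => c0 + (c1 * x + (c2 * x ^+ 2 + (c3 * x ^+ 3 + c4 * x ^+ 4))))
    (c0 + c2 + c4 * 3).
Proof.
have m1 : has_mean (@normal_prob R 0 1) (fun x => x) 0.
  exact: (normal_odd_moment R (k := 1)).
have m3 := normal_odd_moment R (k := 3) isT.
have m2 := normal_even_moment R 1; have m4 := normal_even_moment R 2.
have H := has_meanD (has_mean_cst (normal_prob 0 1) c0)
  (has_meanD (has_meanZ c1 m1) (has_meanD (has_meanZ c2 m2)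
    (has_meanD (has_meanZ c3 m3) (has_meanZ c4 m4)))).
apply: eq_has_mean H => //.
rewrite !big_ord_recr !big_ord0/= -!mul2n; ring.
Qed.

(** Each of the nine products is expanded, and its coefficients are handed to [normal_poly4]. *)
Lemma hermite_orthogonal (R : realType) (m n : nat) : (m < 3)%N -> (n < 3)%N ->
  has_mean (@normal_prob R 0 1) (fun x => hermite m x * hermite n x)
    (if m == n then m`!%:R else 0).
Proof.
case: m => [|[|[|m]]]// _; case: n => [|[|[|n]]]// _ /=.
- by apply: eq_has_mean (normal_poly4 1 0 0 0 0) => [x|];
    rewrite /= ?factS ?fact0; ring.
- by apply: eq_has_mean (normal_poly4 0 1 0 0 0) => [x|];
    rewrite /= ?factS ?fact0; ring.
- by apply: eq_has_mean (normal_poly4 (-1) 0 1 0 0) => [x|];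
    rewrite /= ?factS ?fact0; ring.
- by apply: eq_has_mean (normal_poly4 0 1 0 0 0) => [x|];
    rewrite /= ?factS ?fact0; ring.
- by apply: eq_has_mean (normal_poly4 0 0 1 0 0) => [x|];
    rewrite /= ?factS ?fact0; ring.
- by apply: eq_has_mean (normal_poly4 0 (-1) 0 1 0) => [x|];
    rewrite /= ?factS ?fact0; ring.
- by apply: eq_has_mean (normal_poly4 (-1) 0 1 0 0) => [x|];
    rewrite /= ?factS ?fact0; ring.
- by apply: eq_has_mean (normal_poly4 0 (-1) 0 1 0) => [x|];
    rewrite /= ?factS ?fact0; ring.
- by apply: eq_has_mean (normal_poly4 1 0 (-2) 0 1) => [x|];
    rewrite /= ?factS ?fact0; ring.
Qed.

(** The mean is the inner product with [hermite 0], the constant 1. *)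
Lemma hermite_mean (R : realType) (m : nat) : (m < 3)%N ->
  has_mean (@normal_prob R 0 1) (hermite m) (m == 0)%:R.
Proof.
move=> m3; apply: eq_has_mean (hermite_orthogonal R m3 (isT : 0 < 3)%N) => [x|].
  by rewrite mulr1.
by case: m {m3}.
Qed.

(** * Coordinates of a standard normal vector *)

Section coord.
Context (R : realType) (d : measure_display) (T : measurableType d).
Context (P : probability T R) (n : nat) (X : {RV P >-> n.-tuple R}).

(* [normal_prob] is a measure on [measurableTypeR R], whose display differs from
   that of the default measurable structure on [R]. *)
Lemma measurable_coord (i : 'I_n) :
  measurable_fun (U := measurableTypeR R) [set: T] (fun w => tnth (X w) i).
Proof.
have : measurable_fun [set: T] (fun w => tnth (X w) i).
  exact: (measurableT_comp (measurable_tnth i)).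
exact.
Qed.

Definition coord (i : 'I_n) : {RV P >-> measurableTypeR R} :=
  @mfun_Sub _ _ T (measurableTypeR R) _ (mem_set (measurable_coord i)).

Lemma independent_coord (i j : 'I_n) : independent_components X -> i != j ->
  independent_pair (coord i) (coord j).
Proof.
move=> indX ij A B mA mB.
(* The independence hypothesis takes a family over all indices; only its values at [i] and [j]
   matter once the index set is [{i, j}]. *)
have mAB k : measurable (if k == i then A else B) by case: ifP.
have := indX [set i; j]%SET (fun k => if k == i then A else B) mAB.
rewrite big_setU1 ?inE// big_set1 eqxx eq_sym (negbTE ij) => <-.
congr (P _); apply/seteqP; split => w /=.
  move=> [Aw Bw] k; rewrite !inE => /orP[]/eqP ->; first by rewrite eqxx.
  by rewrite eq_sym (negbTE ij).
move=> H; split.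
  by have := H i; rewrite eqxx; apply; rewrite !inE eqxx.
by have := H j; rewrite eq_sym (negbTE ij); apply; rewrite !inE eqxx orbT.
Qed.

Hypothesis sX : standard_normal X.

Lemma has_mean_coord (i : 'I_n) (f : R -> R) (a : R) :
  has_mean (normal_prob 0 1) f a -> has_mean P (fun w => f (tnth (X w) i)) a.
Proof.
exact: (has_mean_law (X := coord i) (mu := normal_prob 0 1) (sX.2 i)).
Qed.

Lemma has_mean_coord2 (i j : 'I_n) (f g : R -> R) (a b : R) : i != j ->
  has_mean (normal_prob 0 1) f a -> has_mean (normal_prob 0 1) g b ->
  has_mean P (fun w => f (tnth (X w) i) * g (tnth (X w) j)) (a * b).
Proof.
move=> ij fa gb.
have [/integrableP[/measurable_EFinP mf _] _] := fa.
have [/integrableP[/measurable_EFinP mg _] _] := gb.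
by apply: (has_mean_independent (independent_coord sX.1 ij)) => //;
  exact: has_mean_coord.
Qed.
End coord.

(* [chaos_deg k] is the pair of Hermite degrees in [X_i] and [Y_i] of the
   [k]-th term of the centred split chi-square variable. *)
Definition chaos_deg (k : 'I_4) : nat * nat :=
  nth (0, 0)%N [:: (2, 0); (1, 0); (1, 1); (0, 2)]%N k.

Definition chaos (R : realType) (n : nat) (j : 'I_n * 'I_4)
    (x y : n.-tuple R) : R :=
  hermite (chaos_deg j.2).1 (tnth x j.1) *
  hermite (chaos_deg j.2).2 (tnth y j.1).

(** The squared norm of a term: degree [n] contributes $n!$, so the four values are 2, 1, 1, 2. *)
Definition chaos_norm (R : realType) (k : 'I_4) : R :=
  (chaos_deg k).1`!%:R * (chaos_deg k).2`!%:R.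

(** Different terms at the same coordinate therefore differ in a degree, which makes them
    orthogonal. *)
Lemma chaos_deg_inj : injective chaos_deg.
Proof.
by move=> [[|[|[|[|i]]]] hi] [[|[|[|[|j]]]] hj]//= _; apply: val_inj.
Qed.

Lemma chaos_deg_lt (k : 'I_4) :
  ((chaos_deg k).1 < 3)%N /\ ((chaos_deg k).2 < 3)%N.
Proof. by case: k => [[|[|[|[|k]]]] hk]. Qed.

(** * Mean and orthogonality of the chaos terms *)

Section chaos.
Context (R : realType) (dT : measure_display) (T : measurableType dT).
Context (P : probability T R) (n : nat) (X Y : {RV P >-> n.-tuple R}).
Hypotheses (sX : standard_normal X) (sY : standard_normal Y).
Hypothesis indXY : independent_pair X Y.

Lemma has_mean_tuple_prod (f g : n.-tuple R -> R) (a b : R) :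
  measurable_fun setT f -> measurable_fun setT g ->
  has_mean P (fun w => f (X w)) a -> has_mean P (fun w => g (Y w)) b ->
  has_mean P (fun w => f (X w) * g (Y w)) (a * b).
Proof. by move=> mf mg fa gb; apply: (has_mean_independent indXY). Qed.

Let mh (m : nat) (i : 'I_n) :
  measurable_fun [set: n.-tuple R] (fun x => hermite m (tnth x i)).
Proof.
apply: (@measurableT_comp _ _ _ _ _ _ _ _ (fun x : n.-tuple R => tnth x i)).
  exact: measurable_hermite.
exact: measurable_tnth.
Qed.

(** No degree pair is $(0, 0)$, so one of the two independent factors is centred. *)
Lemma chaos_mean (j : 'I_n * 'I_4) :
  has_mean P (fun w => chaos j (X w) (Y w)) 0.
Proof.
have [lt1 lt2] := chaos_deg_lt j.2.
have H := has_mean_tuple_prod (mh _ _) (mh _ _)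
  (has_mean_coord sX j.1 (hermite_mean R lt1))
  (has_mean_coord sY j.1 (hermite_mean R lt2)).
apply: eq_has_mean H => //.
by case: (j.2) => [[|[|[|[|k]]]] hk]//=; rewrite ?mulr0 ?mul0r.
Qed.

Lemma chaos_orthogonal (i j : 'I_n * 'I_4) :
  has_mean P (fun w => chaos i (X w) (Y w) * chaos j (X w) (Y w))
    (if i == j then chaos_norm R i.2 else 0).
Proof.
have [i1 i2] := chaos_deg_lt i.2; have [j1 j2] := chaos_deg_lt j.2.
have [ij|ij] := eqVneq i.1 j.1.
  have H := has_mean_tuple_prod
    (measurable_funM (mh (chaos_deg i.2).1 i.1) (mh (chaos_deg j.2).1 i.1))
    (measurable_funM (mh (chaos_deg i.2).2 i.1) (mh (chaos_deg j.2).2 i.1))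
    (has_mean_coord sX i.1 (hermite_orthogonal R i1 j1))
    (has_mean_coord sY i.1 (hermite_orthogonal R i2 j2)).
  apply: eq_has_mean H => [w|]; first by rewrite /chaos -ij /=; ring.
  (* At a common coordinate, distinct terms have different degrees in [X] or in [Y], and the
     corresponding Hermite inner product is 0. *)
  have [->|ne] := eqVneq i j; first by rewrite !eqxx.
  have : chaos_deg i.2 != chaos_deg j.2.
    apply: contraNneq ne => /chaos_deg_inj e.
    by rewrite [i]surjective_pairing [j]surjective_pairing ij e.
  rewrite [chaos_deg i.2]surjective_pairing [chaos_deg j.2]surjective_pairing.
  rewrite xpair_eqE /=.
  by do 2 case: eqP => //= _; rewrite ?mulr0 ?mul0r.
(* At distinct coordinates the four factors have a mean that splits into four means, and one of the
   two coming from the term [i] is 0. *)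
have H := has_mean_tuple_prod
  (measurable_funM (mh (chaos_deg i.2).1 i.1) (mh (chaos_deg j.2).1 j.1))
  (measurable_funM (mh (chaos_deg i.2).2 i.1) (mh (chaos_deg j.2).2 j.1))
  (has_mean_coord2 sX ij (hermite_mean R i1) (hermite_mean R j1))
  (has_mean_coord2 sY ij (hermite_mean R i2) (hermite_mean R j2)).
apply: eq_has_mean H => [w|]; first by rewrite /chaos /=; ring.
have /negbTE -> : i != j by apply: contraNneq ij => ->.
by case: (i.2) => [[|[|[|[|k]]]] hk]//=; rewrite !(mul0r, mulr0).
Qed.

Lemma has_mean_chaos_sum (c : 'I_n -> 'I_4 -> R) :
  has_mean P (fun w => \sum_i \sum_k c i k * chaos (i, k) (X w) (Y w)) 0 /\
  has_mean P (fun w => (\sum_i \sum_k c i k * chaos (i, k) (X w) (Y w)) ^+ 2)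
    (\sum_i \sum_k c i k ^+ 2 * chaos_norm R k).
Proof.
have pairE w : \sum_i \sum_k c i k * chaos (i, k) (X w) (Y w) =
    \sum_j c j.1 j.2 * chaos j (X w) (Y w).
  by rewrite pair_bigA; apply: eq_bigr => -[].
split.
  have H := has_mean_sum (fun j => has_meanZ (c j.1 j.2) (chaos_mean j)).
  apply: eq_has_mean H => [w|]; first by rewrite pairE.
  by rewrite big1// => j _; rewrite mulr0.
have H := has_mean_orthogonal_sum (fun j => c j.1 j.2) chaos_orthogonal.
apply: eq_has_mean H => [w|]; first by rewrite pairE.
by rewrite pair_bigA.
Qed.

End chaos.

(** * Expansion of the split chi-square expression *)

Section expansion.
Context (R : realType) (d p : nat) (hp : (p <= d)%N) (m0 : R) (h : 'cV[R]_p).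

(* [h] padded with zeros to length [d]. *)
Definition shift (i : 'I_d) : R :=
  if insub (val i) is Some j then h j ord0 else 0.

(** In the order of [chaos_deg]: the coefficients of $X_i^2 - 1$, $X_i$, $X_i Y_i$ and $Y_i^2 -
    1$. *)
Definition chaos_coef (i : 'I_d) (k : 'I_4) : R :=
  nth 0 [:: (i < p)%:R - 1; 2 * Num.sqrt m0 * shift i;
            2 * Num.sqrt (m0 / (1 - m0)); - Num.sqrt (m0 / (1 - m0)) ^+ 2] k.

(** Lets the norm of the first [p] components be summed over all [d] coordinates, alongside the
    other norm. *)
Lemma sum_first (F : 'I_d -> R) :
  \sum_(i < d) (i < p)%:R * F i = \sum_(j < p) F (widen_ord hp j).
Proof.
rewrite -big_ord_narrow/= [RHS]big_mkcond/=.
by apply: eq_bigr => i _; case: ifP; rewrite ?mul1r ?mul0r.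
Qed.

Lemma shift_widen (j : 'I_p) : shift (widen_ord hp j) = h j ord0.
Proof. by rewrite /shift/= valK. Qed.

Lemma shift_first (i : 'I_d) : (i < p)%:R * shift i = shift i.
Proof.
by rewrite /shift; case: insubP => [j -> _|_]; rewrite ?mul1r ?mulr0.
Qed.

Lemma sum_shift_sqr : \sum_i shift i ^+ 2 = (h^T *m h) ord0 ord0.
Proof.
rewrite (eq_bigr (fun i : 'I_d => (i < p)%:R * shift i ^+ 2)); last first.
  by move=> i _; rewrite expr2 mulrA shift_first.
rewrite sum_first mxE; apply: eq_bigr => j _.
by rewrite shift_widen mxE expr2.
Qed.

Lemma sum_lt : \sum_(i < d) (i < p)%:R = p%:R :> R.
Proof.
under eq_bigr do rewrite -[_%:R]mulr1.
by rewrite sum_first sumr_const card_ord.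
Qed.

Lemma enorm_sqr (n : nat) (x : 'cV[R]_n) : enorm x ^+ 2 = \sum_i x i ord0 ^+ 2.
Proof. by rewrite sqr_sqrtr// sumr_ge0// => i _; rewrite sqr_ge0. Qed.

Hypothesis hm0 : 0 < m0 < 1.

Lemma split_chi2_expr_chaos (x y : d.-tuple R) :
  split_chi2_expr hp m0 h (tcol x) (tcol y) =
  p%:R - d%:R - d%:R * (m0 / (1 - m0)) + m0 * (h^T *m h) ord0 ord0 +
  \sum_i \sum_k chaos_coef i k * chaos (i, k) x y.
Proof.
have [m0p m01] := andP hm0.
(* [Num.sqrt] is 0 on negative numbers, so squaring it back requires nonnegative radicands; the
   bounds on [m0] provide this. *)
have r0 : 0 <= m0 / (1 - m0) by rewrite divr_ge0// ?subr_ge0 ltW.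
have aa : Num.sqrt m0 ^+ 2 = m0 by rewrite sqr_sqrtr// ltW.
have cc : Num.sqrt (m0 / (1 - m0)) ^+ 2 = m0 / (1 - m0) by rewrite sqr_sqrtr.
(* The constant is spread over the coordinates, which reduces the identity to one for each [i]. *)
have -> : p%:R - d%:R - d%:R * (m0 / (1 - m0)) + m0 * (h^T *m h) ord0 ord0 =
    \sum_(i < d) ((i < p)%:R - 1 - m0 / (1 - m0) + m0 * shift i ^+ 2).
  rewrite big_split/= -mulr_sumr sum_shift_sqr; congr (_ + _).
  by rewrite !sumrB sum_lt !sumr_const card_ord mulr_natl.
rewrite /split_chi2_expr !enorm_sqr -big_split/=.
under eq_bigr => j _ do rewrite !mxE -shift_widen.
rewrite -(sum_first (fun i => (tnth x i + Num.sqrt m0 * shift i) ^+ 2)) -sumrB.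
apply: eq_bigr => i _; rewrite !mxE.
rewrite !big_ord_recl big_ord0 /chaos_coef /chaos /=.
have sh := shift_first i; set b := (i < p)%:R in sh *.
set a := Num.sqrt m0 in aa *; set c := Num.sqrt (m0 / (1 - m0)) in cc *.
rewrite -cc -aa.
(* The products [b * shift i] are isolated so that [sh] can absorb the indicator. *)
have -> : b * (tnth x i + a * shift i) ^+ 2 =
    b * tnth x i ^+ 2 + 2 * a * (b * shift i) * tnth x i +
    a ^+ 2 * (b * shift i * shift i).
  by ring.
by rewrite sh; ring.
Qed.

Lemma sum_chaos_coef : \sum_i \sum_k chaos_coef i k ^+ 2 * chaos_norm R k =
  2 * (d%:R - p%:R) + 4 * d%:R * (m0 / (1 - m0))
  + 2 * d%:R * (m0 ^+ 2 / (1 - m0) ^+ 2) + 4 * m0 * (h^T *m h) ord0 ord0.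
Proof.
have [m0p m01] := andP hm0.
have r0 : 0 <= m0 / (1 - m0) by rewrite divr_ge0// ?subr_ge0 ltW.
have aa : Num.sqrt m0 ^+ 2 = m0 by rewrite sqr_sqrtr// ltW.
have cc : Num.sqrt (m0 / (1 - m0)) ^+ 2 = m0 / (1 - m0) by rewrite sqr_sqrtr.
rewrite -sum_shift_sqr -expr_div_n; set r := m0 / (1 - m0) in cc *.
rewrite (eq_bigr (fun i : 'I_d => 2 * (1 - (i < p)%:R) + (4 * r + 2 * r ^+ 2)
    + 4 * m0 * shift i ^+ 2)); last first.
  move=> i _; rewrite !big_ord_recl big_ord0 /chaos_coef /chaos_norm /=.
  (* The indicator is 0 or 1, which makes this coefficient's square linear in it. *)
  have bE : ((i < p)%:R - 1) ^+ 2 = 1 - (i < p)%:R :> R.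
    by case: (i < p)%N => /=; ring.
  rewrite !factS !fact0 -/r bE; set a := Num.sqrt m0 in aa *.
  by set c := Num.sqrt r in cc *; rewrite -cc -aa; ring.
clearbody r.
rewrite !big_split/= -!mulr_sumr sumrB sum_lt !sumr_const card_ord.
by rewrite -mulr_natr; ring.
Qed.

End expansion.

(** * Transfer of mean and variance through the law of [Z] *)

Theorem corollary3p4 (R : realType) (d p : nat) (hp : (p <= d)%N)
    (delta m0 : R) (hdelta : 0 <= delta) (hm0 : 0 < m0 < 1)
    (dT : measure_display) (T : measurableType dT) (P : probability T R)
    (Z : {RV P >-> R}) (hZ : split_chi2 hp m0 delta (distribution P Z)) :
  ('E_P[Z] = (p%:R - d%:R - d%:R * (m0 / (1 - m0)) + m0 * delta)%:E)%E /\
  ('V_P[Z] = (2 * (d%:R - p%:R) + 4 * d%:R * (m0 / (1 - m0))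
              + 2 * d%:R * (m0 ^+ 2 / (1 - m0) ^+ 2) + 4 * m0 * delta)%:E)%E.
Proof.
case: hZ => d' [T' [P' [X [Y [h [sX sY indXY hd lawZ]]]]]].
have [S1 S2] := has_mean_chaos_sum sX sY indXY (chaos_coef m0 h).
rewrite (sum_chaos_coef hp h hm0) hd in S2.
set m := p%:R - _ - _ + _; set v := _ + 4 * m0 * delta.
pose W w := split_chi2_expr hp m0 h (tcol (X w)) (tcol (Y w)).
have WE w : W w =
    m + \sum_i \sum_k chaos_coef m0 h i k * chaos (i, k) (X w) (Y w).
  by rewrite /W (split_chi2_expr_chaos hp h hm0) hd.
have Wm : has_mean P' W m.
  apply: eq_has_mean (has_meanD (has_mean_cst P' m) S1) => [w|].
    by rewrite WE.
  by rewrite addr0.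
have Wv : has_mean P' (fun w => (W w - m) ^+ 2) v.
  by apply: eq_has_mean S2 => // w; rewrite WE addrC addKr.
have mW : measurable_fun [set: T'] W.
  by have [/integrableP[/measurable_EFinP]] := Wm.
pose V : {RV P' >-> R} := mfun_Sub (mem_set mW).
(* [Z] and [W] may live on different probability spaces and share only their law, so means of
   functions of [W] pass to [Z] through that law. It is applied to the identity and to the squared
   deviation from [m]. *)
have transfer (f : R -> R) a : measurable_fun [set: R] f ->
    has_mean P' (fun w => f (W w)) a -> has_mean P (f \o Z) a.
  move=> mf fa; apply: (has_mean_law (mu := distribution P' V)).
    by move=> A mA; exact: lawZ.
  exact/(has_mean_distribution V).
have [_ Zm] := transfer id m (@measurable_id _ _ _) Wm.
have mf : measurable_fun [set: R] (fun z => (z - m) ^+ 2).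
  apply: measurable_funX.
  by apply: measurable_funB => //; exact: measurable_cst.
have [_ Zv] := transfer _ v mf Wv.
have EZ : ('E_P[Z] = m%:E)%E by rewrite unlock.
split => //; rewrite /variance unlock EZ unlock -Zv.
by apply: eq_integral => w _; rewrite /= expr2.
Qed.
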